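(* There exists an $O(\log(mn))$-competitive algorithm for random-order (unweighted) set multicover: there is an absolute constant $C$ such that for every instance, the algorithm's expected cost is at most $C\log(mn)$ times the optimal cost.
   Context: Unweighted set multicover: there are $m$ sets, each of unit cost, and $n$ elements; $A\in\{0,1\}^{n\times m}$ is the element–set incidence matrix, and each element $e$ has an integer demand $b_e\in\mathbb{Z}_+$. The goal is to choose $x\in\{0,1\}^m$ with $Ax\ge b$ minimizing $\langle\mathbf{1},x\rangle$ (each set may be picked at most once). In the random-order online model, the instance is fixed by an adversary and the elements arrive in a uniformly random order; when an element arrives, the algorithm learns its demand and which sets contain it, and must (irrevocably) pick sets so that the element is covered by at least $b_e$ picked sets. The expected cost is taken over the random order and the algorithm's randomness, and is compared with the offline optimum.
   Formalization: The cost bound is stated only for mn ≠ 1: for one set and one element with demand 1, log(mn) = 0 while every algorithm pays at least 1. Instances are assumed satisfiable so that the optimal cost is defined. *)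

(* Defs.v *)
From HB Require Import structures.
From mathcomp Require Import all_boot all_order all_fingroup all_algebra.
From mathcomp Require Import reals exp.

Set Implicit Arguments.
Unset Strict Implicit.
Unset Printing Implicit Defensive.

Import Order.TTheory GRing.Theory Num.Theory.
Local Open Scope ring_scope.

(* The incidence matrix has one row per element and one column per set, and a
   0/1 vector x is represented by its support, a set of column indices. *)
Record instance (m n : nat) := Instance {
  incidence : 'M[bool]_(n, m);
  demand : 'I_n -> nat
}.

Section Offline.
Variables (m n : nat) (I : instance m n).

(* A x >= b, where (A x)_e = \sum_(j in x) A_ej. *)
Definition feasible (x : {set 'I_m}) : bool :=
  [forall e : 'I_n, (demand I e <= \sum_(j in x) incidence I e j)%N].

(* The default value setT of the arg min is feasible as soon as some x is, so
   this is the optimum of every satisfiable instance. *)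
Definition opt : nat := #|[arg min_(x < setT | feasible x) #|x|]%N|.

End Offline.

(* What is revealed when an element arrives: its demand and the sets that
   contain it, but not its name. *)
Definition request (m : nat) : Type := (nat * {set 'I_m})%type.

(* Past requests, oldest first, each with the sets picked in response. *)
Definition history (m : nat) : Type := seq (request m * {set 'I_m}).

Definition picked (m : nat) (h : history m) : {set 'I_m} :=
  \bigcup_(a <- h) a.2.

(* [response h r P] is the probability of answering request r with the sets P,
   conditionally on h. Sets in P that are already in [picked h] have no effect:
   the solution maintained is the union of the answers.
   The number of sets is known to the algorithm, the number of elements is not. *)
Record online_algorithm (R : realType) (m : nat) := OnlineAlgorithm {
  response : history m -> request m -> {set 'I_m} -> R;
  response_ge0 : forall h r P, 0 <= response h r P;
  response_sum1 : forall h r, \sum_(P : {set 'I_m}) response h r P = 1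
}.

Section Online.
Variables (R : realType) (m : nat) (alg : online_algorithm R m).

(* Starting from h, every run of positive probability on rs covers each request
   upon its arrival. *)
Fixpoint serves (h : history m) (rs : seq (request m)) : Prop :=
  if rs is r :: rs' then
    forall P : {set 'I_m}, 0 < response alg h r P ->
      (r.1 <= #|r.2 :&: picked (rcons h (r, P))|)%N
      /\ serves (rcons h (r, P)) rs'
  else True.

(* Expected total number of picked sets after serving rs from h, over the
   randomness of the algorithm. *)
Fixpoint expected_cost (h : history m) (rs : seq (request m)) : R :=
  if rs is r :: rs' then
    \sum_(P : {set 'I_m})
      response alg h r P * expected_cost (rcons h (r, P)) rs'
  else #|picked h|%:R.

Variables (n : nat) (I : instance m n).

Definition request_of (e : 'I_n) : request m :=
  (demand I e, [set j | incidence I e j]).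

Definition arrivals (s : 'S_n) : seq (request m) :=
  [seq request_of (s i) | i <- enum 'I_n].

Definition random_order_cost : R :=
  (\sum_(s : 'S_n) expected_cost [::] (arrivals s)) / n`!%:R.

End Online.

(* Main.v *)
(* Online learning against a covering potential, as in the LearnOrCover
   algorithm for random-order set cover.

   The guess K is the least power of two above the optimum of the requests seen
   so far, and a phase is a maximal period with constant guess. Within a phase
   the algorithm keeps multiplicative weights on the sets, normalized to a
   distribution p. A request with residual demand d is answered by picking every
   set j independently with probability min(1, d p_j), plus d arbitrary useful
   sets; so its expected cost is at most 2d.

   Learning: a request is poorly covered if p, capped at 1/K, gives its unpicked
   sets mass below d/(4K). The algorithm then doubles the weights of the uncapped
   ones. Any K sets covering the requests of the phase are doubled 3d/4 times in
   total, while the total weight grows by a factor of at most exp(d/(4K)); hence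
   on every run the poorly covered requests of a phase have total residual demand
   at most 8 K ln m.

   Covering: let rho be the total residual demand of the pending elements whose
   arrival would not end the phase, and rho_good the part of it that is well
   covered. Serving a residual demand d decreases rho in expectation by at least
   d rho_good / (8K). The next element being uniform among those pending, the
   average of d is proportional to rho, so the average decrease of
   16 K ln (1 + rho) pays for the average residual demand of the well-covered
   arrivals.

   Guesses at least double from a phase to the next and stay below 2 opt, so the
   sum over the phases is O(opt log(mn)). *)

Require Import Defs.
From HB Require Import structures.
From mathcomp Require Import all_boot all_order all_fingroup all_algebra.
From mathcomp Require Import reals exp.
From mathcomp Require Import sequences zify lra ring.

Set Implicit Arguments.
Unset Strict Implicit.
Unset Printing Implicit Defensive.

Import Order.TTheory GRing.Theory Num.Theory.
Local Open Scope ring_scope.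

(** * Analytic estimates and sums over arrival orders *)

Lemma ler_expRN_half (R : realType) (y : R) :
  0 <= y <= 1 -> expR (- y) <= 1 - y / 2.
Proof.
move=> /andP[y0 y1]; rewrite expRN.
apply: (@le_trans _ _ (1 + y)^-1).
  by rewrite lef_pV2 ?posrE ?expR_gt0 ?expR_ge1Dx//; lra.
by rewrite -[_^-1]mul1r ler_pdivrMr; nra.
Qed.

Lemma ln2_ge_half (R : realType) : 1 / 2 <= ln 2 :> R.
Proof.
have e0 : 0 < expR (- (1 / 2) : R) by exact: expR_gt0.
have h := expR_ge1Dx (- (1 / 2) : R).
have -> : ln 2 = - ln (2^-1) :> R by rewrite lnV ?opprK // posrE.
rewrite lerNr -[leRHS]expRK ler_ln ?posrE ?invr_gt0 //; lra.
Qed.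

(** Concavity of [ln]. The bound is affine in [y], so expectations pass through it. *)
Lemma ler_ln_tangent (R : realType) (x y : R) :
  0 < x -> 0 < y -> ln y <= ln x + (y - x) / x.
Proof.
move=> x0 y0; have -> : y = x * (1 + (y - x) / x) by field; rewrite gt_eqF.
have p : 0 < 1 + (y - x) / x.
  have -> : 1 + (y - x) / x = y / x by field; rewrite gt_eqF.
  exact: divr_gt0.
rewrite lnM ?posrE // lerD2l.
have -> : (x * (1 + (y - x) / x) - x) / x = (y - x) / x by field; rewrite gt_eqF.
apply: le_ln1Dx; lra.
Qed.

Lemma natr_subn_le (R : realType) (r j : nat) :
  (0 < r)%N -> ((r - j)%N%:R : R) <= r%:R * (1 - r%:R^-1) ^+ j.
Proof.
move=> r0; have r0' : 0 < r%:R :> R by rewrite ltr0n.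
have i1 : 0 <= 1 - r%:R^-1 :> R by rewrite subr_ge0 invf_le1 // ler1n.
have i0 : 0 <= r%:R^-1 :> R by rewrite invr_ge0 ltW.
case: (leqP r j) => [rj | /ltnW jr].
  by rewrite (eqP rj) mulr_ge0 ?exprn_ge0 // ltW.
have bernoulli : 1 - j%:R * r%:R^-1 <= (1 - r%:R^-1 : R) ^+ j.
  elim: j {jr} => [|j IH]; first by rewrite mul0r expr0; lra.
  rewrite exprSr; apply: (le_trans _ (ler_wpM2r i1 IH)).
  rewrite -[j.+1]addn1 natrD.
  have : 0 <= j%:R * r%:R^-1 * r%:R^-1 :> R by rewrite !mulr_ge0.
  lra.
apply: (le_trans _ (ler_wpM2l (ltW r0') bernoulli)).
by rewrite natrB // mulrBr mulr1 mulrCA mulfV ?mulr1 ?gt_eqF.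
Qed.

(** The map from [s] to its list of values is injective and both sides have [n!] terms. Lists allow
    the first arrival to be split off. *)
Lemma big_perm_permutations (R : realType) (n : nat) (F : seq 'I_n -> R) :
  \sum_(s : 'S_n) F [seq s i | i <- enum 'I_n]
    = \sum_(t <- permutations (enum 'I_n)) F t.
Proof.
pose f (s : 'S_n) := [seq s i | i <- enum 'I_n].
have finj : injective f.
  by move=> s t /eq_in_map st; apply/permP => i; apply: st; rewrite mem_enum.
rewrite -(big_map f predT F) /=; apply: perm_big.
have us : uniq (map f (index_enum {perm 'I_n})).
  by rewrite map_inj_uniq // index_enum_uniq.
apply: uniq_perm => //; first exact: permutations_uniq.
have sub : {subset map f (index_enum {perm 'I_n})
               <= permutations (enum 'I_n)}.
  move=> _ /mapP[s _ ->]; rewrite mem_permutations.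
  apply: uniq_perm; [|exact: enum_uniq|].
    by rewrite map_inj_uniq ?enum_uniq //; exact: perm_inj.
  move=> i; rewrite mem_enum; apply/mapP; exists (s^-1%g i); first by rewrite mem_enum.
  by rewrite permKV.
have sz : (size (permutations (enum 'I_n))
             <= size (map f (index_enum {perm 'I_n})))%N.
  by rewrite size_permutations ?enum_uniq // size_map size_enum_ord -card_Sn
    cardT enumT [index_enum _]unlock.
by have [_ h] := uniq_min_size us sub sz.
Qed.

(** Conditioning on the first arrival. *)
Lemma big_permutations (R : realType) (T : eqType) (U : seq T) (F : seq T -> R) :
  uniq U -> (0 < size U)%N ->
  \sum_(t <- permutations U) F t
    = \sum_(x <- U) \sum_(t <- permutations (rem x U)) F (x :: t).
Proof.
move=> uU U0; rewrite (perm_big _ (permutationsE U0)) /=.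
by rewrite big_allpairs_dep undup_id.
Qed.

(** * Independent sampling of subsets *)

Section Sampling.
Variables (R : realType) (I : finType).
Implicit Types (q g : I -> R) (X : {set I}).

Definition sample q X : R := \prod_i (if i \in X then q i else 1 - q i).

(** Generating function of the sample: expanding the product over [i] gives one term per subset. *)
Lemma sum_sample_prod q g :
  \sum_X sample q X * \prod_(i in X) g i = \prod_i (1 - q i + q i * g i).
Proof.
transitivity (\prod_i (q i * g i + (1 - q i))); last first.
  by apply: eq_bigr => i _; rewrite addrC.
rewrite bigA_distr; apply: eq_bigr => X _.
rewrite (big_mkcond (mem X)) /= -big_split /=; apply: eq_bigr => i _.
by case: ifP; rewrite ?mulr1.
Qed.

Lemma sum_sample q : \sum_X sample q X = 1.
Proof.
have := sum_sample_prod q (fun=> 1); rewrite [RHS]big1 => [<-|i _]; last first.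
  by rewrite mulr1 subrK.
by apply: eq_bigr => X _; rewrite big1 ?mulr1.
Qed.

Lemma sum_sample_card q : \sum_X sample q X * #|X|%:R = \sum_i q i.
Proof.
have mem i : \sum_X sample q X * (i \in X)%:R = q i.
  (* The indicator of [i \in X] is one minus a product that vanishes exactly when [X] contains
     [i]. *)
  have -> : \sum_X sample q X * (i \in X)%:R
      = \sum_X sample q X
        - \sum_X sample q X * \prod_(j in X) (if j == i then 0 else 1).
    rewrite -sumrB; apply: eq_bigr => X _; rewrite -[X in X - _]mulr1 -mulrBr.
    congr (_ * _); case: (boolP (i \in X)) => iX.
      by rewrite (bigD1 i) //= eqxx mul0r subr0.
    rewrite big1 ?subrr // => j jX; case: eqP => // ji.
    by rewrite ji (negbTE iX) in jX.
  rewrite sum_sample sum_sample_prod (bigD1 i) //= eqxx mulr0 addr0 big1.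
    by rewrite mulr1; ring.
  by move=> j /negbTE ->; rewrite mulr1 subrK.
transitivity (\sum_X \sum_i sample q X * (i \in X)%:R).
  apply: eq_bigr => X _; rewrite -mulr_sumr; congr (_ * _).
  by rewrite -sum1_card natr_sum big_mkcond /=; apply: eq_bigr => i _; case: ifP.
by rewrite exchange_big /=; apply: eq_bigr.
Qed.

Lemma sample_ge0 q X : (forall i, 0 <= q i <= 1) -> 0 <= sample q X.
Proof.
move=> q01; apply: prodr_ge0 => i _; case: ifP => _; first by case/andP: (q01 i).
by rewrite subr_ge0; case/andP: (q01 i).
Qed.

(* The truncated subtraction is linearized by [(r - j)^+ <= r (1 - 1/r)^j],
   whose expectation factors over the independent choices. *)
Lemma sample_residual q (A : {set I}) (r : nat) (y : R) :
  (forall i, 0 <= q i <= 1) -> r%:R * y <= \sum_(i in A) q i ->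
  \sum_X sample q X * (r - #|A :&: X|)%N%:R <= r%:R * expR (- y).
Proof.
move=> q01; case: (posnP r) => [->|r0] hy.
  by rewrite mul0r big1 // => X _; rewrite sub0n mulr0.
have r0' : 0 < r%:R :> R by rewrite ltr0n.
pose g i : R := if i \in A then 1 - r%:R^-1 else 1.
apply: (@le_trans _ _ (r%:R * \sum_X sample q X * \prod_(i in X) g i)).
  rewrite mulr_sumr; apply: ler_sum => X _.
  rewrite mulrCA ler_wpM2l ?sample_ge0 //.
  apply: (le_trans (natr_subn_le R #|A :&: X| r0)).
  rewrite le_eqVlt; apply/orP; left; apply/eqP; congr (_ * _).
  rewrite /g -big_mkcondr /= prodr_const; congr (_ ^+ _).
  by apply: eq_card => i; rewrite !inE andbC.
rewrite ler_wpM2l ?(ltW r0') // sum_sample_prod.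
apply: (@le_trans _ _ (\prod_i expR (- (if i \in A then q i / r%:R else 0)))).
  apply: ler_prod => i _; apply/andP; split.
    case/andP: (q01 i) => q0 q1; rewrite /g; case: ifP => _; last by rewrite mulr1 subrK.
    have : 0 <= q i * (1 - r%:R^-1).
      by rewrite mulr_ge0 // subr_ge0 invf_le1 // ler1n.
    lra.
  rewrite /g; case: ifP => _; last by rewrite mulr1 subrK oppr0 expR0.
  apply: le_trans (expR_ge1Dx _); rewrite le_eqVlt; apply/orP; left; apply/eqP.
  by ring.
rewrite -expR_sum ler_expR sumrN lerN2 -big_mkcond /= -mulr_suml.
by rewrite ler_pdivlMr // mulrC.
Qed.

End Sampling.

(** * Cover numbers, guesses and residual demands *)

Section Covering.
Variable m : nat.
Implicit Types (x P T : {set 'I_m}) (r : request m) (rs : seq (request m)).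

Definition covers x r := (r.1 <= #|r.2 :&: x|)%N.

Definition cover_number rs : nat :=
  #|[arg min_(x < setT | all (covers x) rs) #|x|]%N|.

(** As [up_log 2 0 = 0], the guess is 1 while nothing has to be covered. *)
Definition guess rs : nat := (2 ^ up_log 2 (cover_number rs))%N.

Definition residual P r : nat := (r.1 - #|r.2 :&: P|)%N.

Lemma covers_setT x r : covers x r -> covers setT r.
Proof. by move/leq_trans; apply; rewrite subset_leq_card // setIS. Qed.

Lemma cover_numberP rs x : all (covers x) rs ->
  (exists2 T, all (covers T) rs & #|T| = cover_number rs)
  /\ (cover_number rs <= #|x|)%N.
Proof.
move=> xrs; rewrite /cover_number; case: arg_minnP => [|T Trs Tmin].
  by apply/allP => r /(allP xrs)/covers_setT.
by split; [exists T|apply: Tmin].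
Qed.

Lemma guess_gt0 rs : (0 < guess rs)%N.
Proof. by rewrite expn_gt0. Qed.

Lemma cover_number_le_guess rs : (cover_number rs <= guess rs)%N.
Proof. exact: up_logP. Qed.

Lemma guess_mono rs rs' x : all (covers x) rs' -> {subset rs <= rs'} ->
  (guess rs <= guess rs')%N.
Proof.
move=> xrs' sub; rewrite leq_exp2l // leq_up_log //.
have [[T Trs' <-] _] := cover_numberP xrs'.
have Trs : all (covers T) rs by apply/allP => r /sub/(allP Trs').
by have [] := cover_numberP Trs.
Qed.

Lemma guess_jump rs rs' : (guess rs < guess rs')%N -> (2 * guess rs <= guess rs')%N.
Proof. by rewrite ltn_exp2l // -expnS leq_exp2l. Qed.

Lemma demand_le_guess rs r x : all (covers x) rs -> r \in rs ->
  (r.1 <= guess rs)%N.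
Proof.
move=> xrs rrs; have [[T Trs Tc] _] := cover_numberP xrs.
apply: leq_trans (cover_number_le_guess _); rewrite -Tc.
by apply: leq_trans (allP Trs _ rrs) _; rewrite subset_leq_card // subsetIr.
Qed.

Lemma residual_setU P X r :
  residual (P :|: X) r = (residual P r - #|(r.2 :\: P) :&: X|)%N.
Proof.
rewrite /residual -subnDA; congr (_ - _)%N.
rewrite -cardsUI [X in (_ + X)%N](_ : _ = 0%N) ?addn0; last first.
  by apply/eqP; rewrite cards_eq0; apply/eqP/setP => j; rewrite !inE; case: (j \in P);
     rewrite !(andbF, andbT).
by apply: eq_card => j; rewrite !inE; case: (j \in P); case: (j \in r.2).
Qed.

Lemma residual_subset P P' r : P \subset P' -> (residual P' r <= residual P r)%N.
Proof. by move=> PP'; rewrite leq_sub2l // subset_leq_card // setIS. Qed.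

Lemma residual_cover T P r : covers T r ->
  (residual P r <= #|T :&: (r.2 :\: P)|)%N.
Proof.
move=> Tr; rewrite /residual leq_subLR; apply: leq_trans Tr _.
rewrite -(cardsID P (r.2 :&: T)) leq_add // subset_leq_card //.
  by apply/subsetP => j; rewrite !inE => /andP[/andP[-> _] ->].
by apply/subsetP => j; rewrite !inE => /andP[-> /andP[-> ->]].
Qed.

Lemma guess_le rs x : all (covers x) rs ->
  (guess rs <= 2 ^ up_log 2 #|x|)%N.
Proof. by move=> /cover_numberP[_ h]; rewrite leq_exp2l // leq_up_log. Qed.

Lemma residual_le x P r : covers x r -> (residual P r <= m)%N.
Proof.
move=> xr; apply: leq_trans (leq_subr _ _) _; apply: leq_trans xr _.
by apply: leq_trans (max_card _) _; rewrite card_ord.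
Qed.

End Covering.

(** * The algorithm and its learning guarantee *)

Section Algorithm.
Variables (R : realType) (m : nat).
Implicit Types (K : nat) (c : 'I_m -> nat) (P T X : {set 'I_m}) (r : request m).

Definition prob c j : R := 2 ^+ c j / \sum_i 2 ^+ c i.

Definition capped K c j : R := Num.min (prob c j) K%:R^-1.

Definition well_covered K c P r : bool :=
  (residual P r)%:R / (4 * K%:R) <= \sum_(j in r.2 :\: P) capped K c j.

Definition bump K c P r j : bool :=
  [&& ~~ well_covered K c P r, j \in r.2 :\: P & prob c j <= K%:R^-1].

(* [missed] is not used by the algorithm: it is the total residual demand of
   the requests of the current phase that were not well covered on arrival. *)
Record state := State {
  seen : seq (request m);
  bought : {set 'I_m};
  hits : 'I_m -> nat;
  missed : nat
}.

Definition same_phase (st : state) r : bool :=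
  guess (rcons (seen st) r) == guess (seen st).

Definition hits_upon st r : 'I_m -> nat :=
  if same_phase st r then hits st else fun=> 0%N.

Definition step (st : state) (a : request m * {set 'I_m}) : state :=
  let K := guess (rcons (seen st) a.1) in
  let c := hits_upon st a.1 in
  let P := bought st in
  State (rcons (seen st) a.1) (P :|: a.2)
    (fun j => c j + bump K c P a.1 j)%N
    ((if same_phase st a.1 then missed st else 0)
      + (if well_covered K c P a.1 then 0 else residual P a.1))%N.

(** The state is a deterministic function of the history, so it can be recomputed at each
    response. *)
Definition run (h : history m) : state :=
  foldl step (State [::] set0 (fun=> 0%N) 0) h.

Definition inclusion st r j : R :=
  Num.min 1 ((residual (bought st) r)%:R * prob (hits_upon st r) j).

Definition backup P r : {set 'I_m} :=
  [set j in take (residual P r) (enum (r.2 :\: P))].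

Definition learn_or_cover_response (h : history m) r (A : {set 'I_m}) : R :=
  \sum_X sample (inclusion (run h) r) X
    * (X :|: backup (bought (run h)) r == A)%:R.

Lemma run_rcons h a : run (rcons h a) = step (run h) a.
Proof. by rewrite /run -cats1 foldl_cat. Qed.

Lemma bought_run h : bought (run h) = picked h.
Proof.
elim/last_ind: h => [|h a IH]; first by rewrite /picked big_nil.
by rewrite run_rcons /= IH /picked -cats1 big_cat /= big_seq1.
Qed.

Lemma picked_rcons (h : history m) a : picked (rcons h a) = picked h :|: a.2.
Proof. by rewrite /picked -cats1 big_cat /= big_seq1. Qed.

Lemma prob_ge0 c j : 0 <= prob c j.
Proof. by rewrite divr_ge0 ?sumr_ge0 // => *; rewrite exprn_ge0. Qed.

Lemma total_gt0 c : 'I_m -> 0 < \sum_i 2 ^+ c i :> R.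
Proof.
move=> j; rewrite (bigD1 j) //= ltr_pwDl ?exprn_gt0 //.
by apply: sumr_ge0 => i _; rewrite exprn_ge0.
Qed.

Lemma sum_prob_le1 c : \sum_j prob c j <= 1.
Proof.
rewrite /prob -mulr_suml.
case: (eqVneq (\sum_i 2 ^+ c i : R) 0) => [->|s0]; first by rewrite mul0r.
by rewrite mulfV.
Qed.

Lemma inclusion01 st r j : 0 <= inclusion st r j <= 1.
Proof.
by rewrite /inclusion le_min ler01 mulr_ge0 ?prob_ge0 //= ge_min lexx.
Qed.

Lemma response_ge0 h r A : 0 <= learn_or_cover_response h r A.
Proof.
by apply: sumr_ge0 => X _; rewrite mulr_ge0 // sample_ge0 // => j; exact: inclusion01.
Qed.

Lemma response_expectation h r (F : {set 'I_m} -> R) :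
  \sum_A learn_or_cover_response h r A * F A
  = \sum_X sample (inclusion (run h) r) X * F (X :|: backup (bought (run h)) r).
Proof.
under eq_bigr do rewrite mulr_suml.
rewrite exchange_big /=; apply: eq_bigr => X _.
rewrite (bigD1 (X :|: backup (bought (run h)) r)) //= eqxx mulr1 big1 ?addr0 //.
by move=> A /negbTE; rewrite eq_sym => ->; rewrite mulr0 mul0r.
Qed.

Lemma response_sum1 h r : \sum_A learn_or_cover_response h r A = 1.
Proof.
rewrite -(sum_sample (inclusion (run h) r)).
under eq_bigr do rewrite -[learn_or_cover_response _ _ _]mulr1.
rewrite (response_expectation _ _ (fun=> 1)).
by under eq_bigr do rewrite mulr1.
Qed.

Definition learn_or_cover : online_algorithm R m :=
  OnlineAlgorithm response_ge0 response_sum1.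

Lemma backup_sub P r : backup P r \subset r.2 :\: P.
Proof.
by apply/subsetP => j; rewrite inE => /mem_take; rewrite mem_enum.
Qed.

Lemma card_backup P r : #|backup P r| = minn (residual P r) #|r.2 :\: P|.
Proof.
rewrite /backup cardsE (card_uniqP _) ?take_uniq ?enum_uniq //.
by rewrite size_take_min -cardE.
Qed.

(** The backup alone suffices: it is disjoint from [P], and satisfiability leaves enough useful sets
    to meet the residual demand. *)
Lemma backup_covers P X r : covers setT r -> covers (P :|: (X :|: backup P r)) r.
Proof.
rewrite /covers setIT => r_sat.
apply: (@leq_trans #|(r.2 :&: P) :|: backup P r|); last first.
  rewrite subset_leq_card //; apply/subsetP => j; rewrite !inE.
  case/orP => [/andP[-> ->]//|jB]; have := subsetP (backup_sub P r) j.
  by rewrite !inE jB => /(_ isT) /andP[_ ->]; rewrite !orbT.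
have dis : (r.2 :&: P) :&: backup P r = set0.
  apply/setP => j; rewrite !inE; apply/negP => /andP[/andP[_ jP] jB].
  have := subsetP (backup_sub P r) j.
  by rewrite !inE jP jB => /(_ isT).
rewrite cardsU dis cards0 subn0 card_backup.
by have := cardsID P r.2; rewrite /residual; lia.
Qed.

Lemma serves_learn_or_cover h rs :
  {in rs, forall r, covers setT r} -> serves learn_or_cover h rs.
Proof.
elim: rs h => //= r rs IH h sat A A0; split; last first.
  by apply: IH => r' r'rs; apply: sat; rewrite inE r'rs orbT.
rewrite picked_rcons /=.
case: (pickP (fun X => X :|: backup (bought (run h)) r == A)) => [X /eqP <-|none].
  rewrite bought_run; apply: (backup_covers (picked h) X).
  by apply: sat; rewrite inE eqxx.
by move: A0; rewrite /= /learn_or_cover_response big1 ?ltxx // => X _; rewrite none mulr0.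
Qed.

(** Truncation at 1 only lowers the inclusion probabilities, so the sample has expected size at most
    [d]; the backup adds at most [d]. *)
Lemma expected_purchase h r :
  \sum_A learn_or_cover_response h r A * #|picked (rcons h (r, A))|%:R
  <= #|picked h|%:R + 2 * (residual (picked h) r)%:R.
Proof.
under eq_bigr do rewrite picked_rcons /=.
rewrite (response_expectation _ _ (fun A => #|picked h :|: A|%:R)).
set q := inclusion _ _; set P := picked h; set d := residual P r.
apply: (@le_trans _ _ (\sum_X sample q X * (#|P|%:R + #|X|%:R + d%:R))).
  apply: ler_sum => X _; rewrite ler_wpM2l ?sample_ge0 //.
    by move=> j; exact: inclusion01.
  rewrite -!natrD ler_nat bought_run -/P -addnA.
  apply: leq_trans (leq_card_setU _ _) _; rewrite leq_add2l.
  by apply: leq_trans (leq_card_setU _ _) _; rewrite leq_add2l card_backup geq_minl.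
rewrite [leLHS](_ : _ = #|P|%:R + d%:R + \sum_X sample q X * #|X|%:R); last first.
  rewrite -[X in X + _]mul1r -(sum_sample q) mulr_suml -big_split /=.
  by apply: eq_bigr => X _; ring.
rewrite sum_sample_card.
have : \sum_j q j <= d%:R.
  apply: (@le_trans _ _ (\sum_j d%:R * prob (hits_upon (run h) r) j)).
    by apply: ler_sum => j _; rewrite /q /inclusion bought_run ge_min lexx orbT.
  rewrite -mulr_sumr -[leRHS]mulr1 ler_wpM2l //; exact: sum_prob_le1.
lra.
Qed.

(* A poorly covered request has few sets whose probability exceeds [1/K], so
   at least 3/4 of its residual demand in any cover [T] is bumped. *)
Lemma bump_cover K c P r T : (0 < K)%N -> covers T r ->
  ~~ well_covered K c P r ->
  3 / 4 * (residual P r)%:R <= (\sum_(j in T) bump K c P r j)%N%:R :> R.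
Proof.
move=> K0 /(residual_cover P) dT bad.
have K0' : 0 < K%:R :> R by rewrite ltr0n.
pose heavy := [set j in r.2 :\: P | K%:R^-1 < prob c j].
have hv : #|heavy|%:R <= (residual P r)%:R / 4 :> R.
  have : #|heavy|%:R * K%:R^-1 <= \sum_(j in r.2 :\: P) capped K c j.
    rewrite mulr_natl -sumr_const [leRHS](bigID (fun j => j \in heavy)) /=.
    rewrite [X in X + _](eq_bigl (fun j => j \in heavy)); last first.
      by move=> j; rewrite !inE; do !case: (_ \in _); rewrite ?andbF ?andbT //=.
    rewrite -[leLHS]addr0 lerD //.
      apply: ler_sum => j; rewrite inE => /andP[_ /ltW h].
      by rewrite /capped le_min h lexx.
    apply: sumr_ge0 => j _; rewrite /capped le_min prob_ge0 invr_ge0 ler0n //.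
  move: bad; rewrite -ltNge => bad h; have {bad h} := le_lt_trans h bad.
  rewrite -ltr_pdivlMr ?invr_gt0 // invrK invfM mulrA mulfVK ?gt_eqF //.
  by move/ltW.
have : (residual P r <= #|heavy| + \sum_(j in T) bump K c P r j)%N.
  apply: leq_trans dT _; rewrite -(cardsID heavy) leq_add //.
    by rewrite subset_leq_card // subsetIr.
  rewrite -sum1_card big_mkcond [X in (_ <= X)%N]big_mkcond /=.
  apply: leq_sum => j _; rewrite /bump bad !inE ltNge /=.
  by case: (j \in T); case: (j \in r.2); case: (j \in P); case: (_ <= _).
rewrite -(ler_nat R) natrD; lra.
Qed.

(** Doubling adds to the total weight the share of the bumped sets. These are uncapped, so their
    share is at most the capped mass, below d/(4K) for a poorly covered request. *)
Lemma bump_weight K c P r : (0 < K)%N ->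
  \sum_j 2 ^+ (c j + bump K c P r j)
  <= (\sum_j 2 ^+ c j)
     * expR ((if well_covered K c P r then 0 else residual P r)%N%:R / (4 * K%:R)) :> R.
Proof.
move=> K0; case: (boolP (well_covered K c P r)) => [good|bad].
  rewrite mul0r expR0 mulr1; apply: ler_sum => j _.
  by rewrite /bump good addn0.
have K0' : 0 < K%:R :> R by rewrite ltr0n.
set W := \sum_j 2 ^+ c j; set y := _ / _.
have W0 : 0 <= W by apply: sumr_ge0 => j _; rewrite exprn_ge0.
apply: (@le_trans _ _ (W * (1 + y))); last by rewrite ler_wpM2l // expR_ge1Dx.
have -> : \sum_j 2 ^+ (c j + bump K c P r j)
    = W + W * \sum_(j | bump K c P r j) prob c j.
  rewrite mulr_sumr (big_mkcond (bump K c P r)) -big_split /=.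
  apply: eq_bigr => j _; case: ifP => _; last by rewrite addn0 addr0.
  have W1 : W != 0 by rewrite gt_eqF // total_gt0.
  by rewrite /prob -/W addn1 exprS mulrCA mulfV //; ring.
rewrite mulrDr mulr1 lerD2l ler_wpM2l //.
apply: (@le_trans _ _ (\sum_(j in r.2 :\: P) capped K c j)); last first.
  by move: bad; rewrite -ltNge => /ltW.
rewrite [leRHS](bigID (bump K c P r)) /= -[leLHS]addr0 lerD //; last first.
  by apply: sumr_ge0 => j _; rewrite /capped le_min prob_ge0 invr_ge0 ler0n.
rewrite le_eqVlt; apply/orP; left; apply/eqP; apply: eq_big => j.
  by rewrite /bump bad; case: (j \in _ :\: _).
by case/and3P => _ _ h; rewrite /capped min_l.
Qed.

(** Invariants of every run. A request opening a phase is accounted for after a reset to no misses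
    and total weight [m]. *)
Lemma run_learning h (st := run h) :
  [/\ forall T, all (covers T) (seen st) ->
        3 / 4 * (missed st)%:R <= (\sum_(j in T) hits st j)%N%:R :> R &
      \sum_j 2 ^+ hits st j
        <= m%:R * expR ((missed st)%:R / (4 * (guess (seen st))%:R)) :> R].
Proof.
rewrite /st {st}; elim/last_ind: h => [|h [r A] [cov wt]].
  split=> /= [T _|]; first by rewrite mulr0.
  by rewrite mul0r expR0 mulr1 sumr_const card_ord.
rewrite run_rcons /=; split.
  move=> T; rewrite all_rcons => /andP[Tr Trs].
  set K := guess _; set c := hits_upon _ _; set P := bought _.
  have K0 : (0 < K)%N := guess_gt0 _.
  rewrite big_split /= !natrD mulrDr lerD //.
    by rewrite /c /hits_upon; case: ifP => _; [exact: cov|rewrite mulr0].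
  by case: (boolP (well_covered K c P r)) => [_|bad]; [rewrite mulr0|exact: bump_cover].
set K := guess _; set c := hits_upon _ _; set P := bought _.
have K0 : (0 < K)%N := guess_gt0 _.
apply: (le_trans (bump_weight c P r K0)).
rewrite natrD (mulrDl _ _ (4 * K%:R)^-1) expRD mulrA ler_wpM2r ?expR_ge0 //.
rewrite /c /hits_upon /K; case: ifP => [/eqP ->|_]; first exact: wt.
by rewrite mul0r expR0 mulr1 sumr_const card_ord.
Qed.

(* Any cover [T] of size at most [K] forces total weight at least
   [2 ^ (3 missed / (4 K))], against the upper bound [m * exp (missed / (4 K))]. *)
Lemma missed_bound h x (st := run h) : (0 < m)%N -> all (covers x) (seen st) ->
  (missed st)%:R <= 8 * (guess (seen st))%:R * ln (m%:R : R).
Proof.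
rewrite {}/st => m0 /cover_numberP[[T Trs Tc] _].
have [/(_ T Trs) cov] := run_learning h.
set c := hits _ in cov *; set b := (missed _)%:R in cov *.
set K := guess _ => wt; have K0 : 0 < K%:R :> R by rewrite ltr0n guess_gt0.
have W0 : 0 < \sum_j 2 ^+ c j :> R := total_gt0 c (Ordinal m0).
have m0' : 0 < m%:R :> R by rewrite ltr0n.
set W := \sum_j _ in wt W0.
have lnW : ln W <= ln (m%:R) + b / (4 * K%:R).
  rewrite -[X in _ + X]expRK -lnM ?posrE ?expR_gt0 // ler_ln ?posrE //.
  by rewrite mulr_gt0 ?expR_gt0.
have cW j : (c j)%:R * (1 / 2) <= ln W.
  apply: (@le_trans _ _ (ln (2 ^+ c j))).
    by rewrite lnXn // -[leRHS]mulr_natl ler_wpM2l // ln2_ge_half.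
  rewrite ler_ln ?posrE ?exprn_gt0 // /W (bigD1 j) //= lerDl.
  by apply: sumr_ge0 => i _; rewrite exprn_ge0.
have lnW0 : 0 <= ln W by apply: le_trans (cW (Ordinal m0)); rewrite mulr_ge0 // divr_ge0.
have : (\sum_(j in T) c j)%N%:R * (1 / 2) <= K%:R * ln W.
  apply: (@le_trans _ _ (#|T|%:R * ln W)); last first.
    by rewrite ler_wpM2r // ler_nat Tc cover_number_le_guess.
  rewrite natr_sum mulr_suml mulr_natl -sumr_const.
  by apply: ler_sum => j _; exact: cW.
(* The bounds combine to 3b/8 <= K ln m + b/4, whence the factor 8. *)
have := ler_wpM2l (ltW K0) lnW.
rewrite mulrDr [X in _ + X](_ : _ = b / 4); last by field; rewrite gt_eqF.
lra.
Qed.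

End Algorithm.

(** * Expected decrease of the load within a phase *)

Section Drift.
Variables (R : realType) (m : nat) (E : eqType) (req : E -> request m).
Variable x : {set 'I_m}.
Hypothesis x_covers : forall e, covers x (req e).
Implicit Types (st : state m) (U : seq E) (X A : {set 'I_m}).

Local Notation step := (step R).
Local Notation K_ st := (guess (seen st)).
Local Notation covered st := (all (covers x) (seen st)).

(** The rho of the covering argument; requests that would open a phase are charged to the growth of
    the guess instead. *)
Definition load st U : nat :=
  \sum_(f <- U | same_phase st (req f)) residual (bought st) (req f).

Definition well_covered_upon st (r : request m) : bool :=
  well_covered R (K_ st) (hits st) (bought st) r.

Definition good_load st U : nat :=
  \sum_(f <- U | same_phase st (req f))
     (if well_covered_upon st (req f) then residual (bought st) (req f) else 0).

Lemma load_le st U : (load st U <= m * size U)%N.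
Proof.
rewrite /load -sum1_size big_distrr big_mkcond /=.
by apply: leq_sum => f _; rewrite muln1; case: ifP => // _; apply: residual_le (x_covers f).
Qed.

(** Purpose of the cap at 1/K: since [d <= K], [d] times a capped probability is at most 1 and
    survives the truncation. *)
Lemma inclusion_ge st r j : same_phase st r ->
  (residual (bought st) r <= K_ st)%N ->
  (residual (bought st) r)%:R * capped R (K_ st) (hits st) j <= inclusion R st r j.
Proof.
move=> same dK; rewrite /inclusion /hits_upon same le_min /capped.
have K0 : 0 < (K_ st)%:R :> R by rewrite ltr0n guess_gt0.
apply/andP; split; last by rewrite ler_wpM2l // ge_min lexx.
apply: (@le_trans _ _ ((residual (bought st) r)%:R * (K_ st)%:R^-1)).
  by rewrite ler_wpM2l // ge_min lexx orbT.
by rewrite ler_pdivrMr // mul1r ler_nat.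
Qed.

(** [sample_residual] gives the factor exp(-y) with y = d/(4K) <= 1, and exp(-y) <= 1 - y/2 turns
    the 4 into an 8. *)
Lemma expected_residual st r f B : same_phase st r ->
  (residual (bought st) r <= K_ st)%N -> well_covered_upon st f ->
  \sum_X sample (inclusion R st r) X * (residual (bought st :|: (X :|: B)) f)%:R
  <= (residual (bought st) f)%:R
     * (1 - (residual (bought st) r)%:R / (8 * (K_ st)%:R)).
Proof.
move=> same dK good; set P := bought st; set d := residual P r; set K := K_ st.
have K0 : 0 < K%:R :> R by rewrite ltr0n guess_gt0.
have q01 := inclusion01 R st r.
apply: (@le_trans _ _ (\sum_X sample (inclusion R st r) X
    * (residual P f - #|(f.2 :\: P) :&: X|)%N%:R)).
  apply: ler_sum => X _; rewrite ler_wpM2l ?sample_ge0 // ler_nat.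
  by rewrite -residual_setU residual_subset // setUA subsetUl.
pose y : R := d%:R / (4 * K%:R).
apply: (le_trans (sample_residual (y := y) q01 _)).
  apply: (@le_trans _ _ (\sum_(j in f.2 :\: P) d%:R * capped R K (hits st) j)).
    rewrite -mulr_sumr /y mulrCA ler_wpM2l //; exact: good.
  by apply: ler_sum => j _; exact: inclusion_ge.
rewrite ler_wpM2l // [X in _ - X](_ : _ = y / 2); last first.
  by rewrite /y; field; rewrite gt_eqF.
apply: ler_expRN_half; rewrite /y divr_ge0 ?mulr_ge0 //=.
rewrite ler_pdivrMr ?mulr_gt0 // mul1r.
have : d%:R <= K%:R :> R by rewrite ler_nat.
lra.
Qed.

(** By monotonicity, the guess after [f] alone lies between the current one and the one after [e]
    and [f], which coincide. *)
Lemma same_phase_step st e f A : covered st ->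
  same_phase st (req e) -> same_phase (step st (req e, A)) (req f) ->
  same_phase st (req f).
Proof.
rewrite /same_phase /= => xst /eqP same /eqP same'; rewrite eqn_leq -{1}same -same'.
rewrite !(@guess_mono _ _ _ x) // ?all_rcons ?xst ?x_covers //.
  by move=> r; rewrite mem_rcons inE => ->; rewrite orbT.
by move=> r; rewrite !(mem_rcons, inE) => /orP[->|->]; rewrite ?orbT.
Qed.

Lemma residual_le_guess st e : covered st -> same_phase st (req e) ->
  (residual (bought st) (req e) <= K_ st)%N.
Proof.
move=> xst /eqP <-; apply: leq_trans (leq_subr _ _) _.
apply: (@demand_le_guess _ _ _ x); first by rewrite all_rcons x_covers.
by rewrite mem_rcons inE eqxx.
Qed.

(** No request joins the load during a phase, well-covered ones shrink by [expected_residual], and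
    the others do not grow. *)
Lemma expected_load st U e (r := req e) : covered st -> e \in U ->
  same_phase st r ->
  \sum_X sample (inclusion R st r) X
    * (load (step st (r, X :|: backup (bought st) r)) (rem e U))%:R
  <= (load st U)%:R
     - (residual (bought st) r)%:R / (8 * (K_ st)%:R) * (good_load st U)%:R.
Proof.
move=> xst eU same; set B := backup _ _; set P := bought st.
set d := residual P r; have dK : (d <= K_ st)%N by exact: residual_le_guess.
have q01 := inclusion01 R st r.
apply: (@le_trans _ _ (\sum_(f <- U | same_phase st (req f))
    \sum_X sample (inclusion R st r) X * (residual (P :|: (X :|: B)) (req f))%:R)).
  rewrite exchange_big /=; apply: ler_sum => X _.
  rewrite -mulr_sumr ler_wpM2l ?sample_ge0 // -natr_sum ler_nat.
  rewrite (big_rem e eU) /= /load.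
  apply: leq_trans (leq_addl _ _).
  rewrite big_mkcond [X in (_ <= X)%N]big_mkcond /=; apply: leq_sum => f _.
  by case: ifP => // /(same_phase_step xst same) ->.
rewrite !natr_sum mulr_sumr -sumrB; apply: ler_sum => f _.
case: ifP => good.
  by apply: (le_trans (expected_residual B same dK good)); rewrite -/P -/d; lra.
rewrite mulr0 subr0 -[leRHS]mul1r -[X in _ <= X * _](sum_sample (inclusion R st r)).
rewrite mulr_suml.
apply: ler_sum => X _; rewrite ler_wpM2l ?sample_ge0 // ler_nat.
by rewrite residual_subset // subsetUl.
Qed.

(** * Potential argument over a random order *)

Section Potential.
(* [N] bounds every load, and [M] every guess. *)
Variables N M : nat.
Local Notation L := (ln (1 + N%:R) : R).
Local Notation lm := (ln m%:R : R).

(* In the order of the summands: the covering potential of the current phase,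
   the budget for the covering and the phase-opening costs of later phases, and
   the learning budgets of the current and of later phases. Since guesses are
   powers of two, a phase with guess [K'] following one with guess [K] is paid
   for by [2 (K' - K) >= K']. *)
Definition potential st U : R :=
  16 * (K_ st)%:R * ln (1 + (load st U)%:R)
  + (32 * L + 2) * (M%:R - (K_ st)%:R)
  + (8 * (K_ st)%:R * lm - (missed st)%:R) + 16 * lm * (M%:R - (K_ st)%:R).

Lemma ln_load_ge0 st U : 0 <= ln (1 + (load st U)%:R) :> R.
Proof. by rewrite ln_ge0 // lerDl. Qed.

Lemma ln_load_le st U : (m * size U <= N)%N -> ln (1 + (load st U)%:R) <= L.
Proof.
move=> UN; rewrite ler_ln ?posrE ?ltr_pwDl // lerD2l ler_nat.
exact: leq_trans (load_le _ _) UN.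
Qed.

Hypothesis m_gt0 : (0 < m)%N.

Let lm_ge0 : 0 <= lm. Proof. by rewrite ln_ge0 // ler1n. Qed.
Let L_ge0 : 0 <= L. Proof. by rewrite ln_ge0 // lerDl. Qed.

(** True for every answer [A]. The old learning budget is nonnegative by [missed_bound]; since 2 (K'
    - K) >= K', the budgets released pay for the new covering potential, the residual demand (at
    most K') and the new learning budget. *)
Lemma potential_new_phase h e U A (st := run R h) : covered st -> e \in U ->
  (m * size U <= N)%N -> ~~ same_phase st (req e) ->
  (residual (bought st) (req e))%:R + potential (step st (req e, A)) (rem e U)
  <= potential st U.
Proof.
move=> xst eU UN new; have mb := missed_bound m_gt0 xst.
set st' := step _ _.
have xst' : covered st' by rewrite /= all_rcons x_covers.
have d_le : (residual (bought st) (req e))%:R <= (K_ st')%:R :> R.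
  rewrite ler_nat; apply: leq_trans (leq_subr _ _) _.
  by apply: (demand_le_guess xst'); rewrite mem_rcons inE eqxx.
have jump : 2 * (K_ st)%:R <= (K_ st')%:R :> R.
  rewrite -natrM ler_nat guess_jump // ltn_neqAle eq_sym new /=.
  by apply: (guess_mono xst') => r; rewrite mem_rcons inE => ->; rewrite orbT.
have K0 : 0 < (K_ st)%:R :> R by rewrite ltr0n guess_gt0.
have lnl := ln_load_ge0 st U.
have lnl' : ln (1 + (load st' (rem e U))%:R) <= L.
  apply: ln_load_le; apply: leq_trans UN; rewrite leq_mul2l size_rem //.
  by rewrite leq_pred orbT.
rewrite /potential -/st; move: (missed st') (ler0n R (missed st')) => b' b'0.
set K := (K_ st)%:R in K0 jump mb *; set K' := (K_ st')%:R in jump d_le *.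
move: (load _ _) (load _ _) lnl lnl' => l' l lnl lnl'.
have a1 : 0 <= K * ln (1 + l%:R) by rewrite mulr_ge0 // ltW.
have K'0 : 0 <= K' by apply: ler0n.
have a2 : K' * ln (1 + l'%:R) <= K' * L by rewrite ler_wpM2l.
have a3 : 0 <= L * (K' - 2 * K) by rewrite mulr_ge0 // subr_ge0.
have a4 : 0 <= lm * (K' - 2 * K) by rewrite mulr_ge0 // subr_ge0.
move: mb d_le; rewrite -/st.
move: (missed st)%:R (residual _ _)%:R => b d mb d_le.
lra.
Qed.

(** If the request is poorly covered, the learning budget pays for [d]. The tangent of [ln] at the
    current load turns the expected decrease d g/(8K), weighted by 16 K, into 2 d g/l. *)
Lemma potential_same_phase h e U (st := run R h) (r := req e) :
  covered st -> e \in U -> same_phase st r ->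
  (residual (bought st) r)%:R
    + \sum_X sample (inclusion R st r) X
        * potential (step st (r, X :|: backup (bought st) r)) (rem e U)
  <= potential st U
     + (if well_covered_upon st r then residual (bought st) r else 0)%N%:R
     - 2 * (residual (bought st) r)%:R * (good_load st U)%:R / (1 + (load st U)%:R).
Proof.
move=> xst eU same; set q := inclusion _ _ _; set B := backup _ _.
set d := residual _ _; set w := (if _ then _ else _).
set l := 1 + (load st U)%:R; set g := (good_load st U)%:R.
have l0 : 0 < l by rewrite ltr_pwDl.
have K0 : 0 < (K_ st)%:R :> R by rewrite ltr0n guess_gt0.
have q01 : forall j, 0 <= q j <= 1 by exact: inclusion01.
pose l' X : R := (load (step st (r, X :|: B)) (rem e U))%:R.
pose c : R := potential st U - 16 * (K_ st)%:R * ln l - (d%:R - w%:R).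
have pot X : potential (step st (r, X :|: B)) (rem e U)
    <= c + 16 * (K_ st)%:R * (ln l + (1 + l' X - l) / l).
  rewrite /c /potential /= (eqP same) same /hits_upon same -/l.
  have t : ln (1 + l' X) <= ln l + (1 + l' X - l) / l.
    by apply: ler_ln_tangent => //; rewrite ltr_pwDl.
  have := ler_wpM2l (ltW K0) t; rewrite -/(l' X).
  rewrite natrD /w /well_covered_upon -/d; case: ifP => _; lra.
apply: (@le_trans _ _ (d%:R + \sum_X sample q X
    * (c + 16 * (K_ st)%:R * (ln l + (1 + l' X - l) / l)))).
  by rewrite lerD2l; apply: ler_sum => X _; rewrite ler_wpM2l ?sample_ge0.
have -> : \sum_X sample q X * (c + 16 * (K_ st)%:R * (ln l + (1 + l' X - l) / l))
    = c + 16 * (K_ st)%:R * (ln l + (1 + \sum_X sample q X * l' X - l) / l).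
  transitivity (\sum_X (sample q X * (c + 16 * (K_ st)%:R * (ln l + (1 - l) / l))
      + sample q X * l' X * (16 * (K_ st)%:R / l))).
    by apply: eq_bigr => X _; ring.
  by rewrite big_split /= -!mulr_suml sum_sample; ring.
have el : \sum_X sample q X * l' X
    <= (load st U)%:R - d%:R / (8 * (K_ st)%:R) * g := expected_load xst eU same.
have h1 : (1 + \sum_X sample q X * l' X - l) / l
    <= - (d%:R / (8 * (K_ st)%:R) * g) / l.
  by rewrite ler_pM2r ?invr_gt0 // /l; lra.
have := ler_wpM2l (ltW K0) h1.
rewrite [X in _ <= X](_ : _ = - (d%:R * g / l) / 8); last first.
  by field; rewrite !gt_eqF.
rewrite /c.
lra.
Qed.

(** The next arrival being uniform in [U], the potential pays on average for the residual demand.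
    Arrivals opening a phase are paid for individually, the others only jointly. *)
Lemma drift h U (st := run R h) : covered st -> (m * size U <= N)%N ->
  \sum_(e <- U) ((residual (bought st) (req e))%:R
    + \sum_X sample (inclusion R st (req e)) X
        * potential (step st (req e, X :|: backup (bought st) (req e))) (rem e U))
  <= (size U)%:R * potential st U.
Proof.
move=> xst UN; pose g : R := (good_load st U)%:R; pose l : R := (load st U)%:R.
apply: (@le_trans _ _ (\sum_(e <- U) (potential st U
    + (if same_phase st (req e) then
         (if well_covered_upon st (req e) then residual (bought st) (req e) else 0)%N%:R
         - (residual (bought st) (req e))%:R * (2 * g / (1 + l))
       else 0)))).
  rewrite big_seq [leRHS]big_seq; apply: ler_sum => e eU; case: ifP => same.
    apply: (le_trans (potential_same_phase xst eU same)).
    by rewrite le_eqVlt; apply/orP; left; apply/eqP; rewrite -/l -/g; ring.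
  rewrite addr0 -[X in X + _]mul1r -[X in X * _ + _](sum_sample (inclusion R st (req e))).
  rewrite mulr_suml -big_split /= -[leRHS]mul1r.
  rewrite -[X in _ <= X * _](sum_sample (inclusion R st (req e))) mulr_suml.
  apply: ler_sum => X _; rewrite -mulrDr ler_wpM2l ?sample_ge0 //.
    by move=> j; exact: inclusion01.
  by apply: potential_new_phase; rewrite // same.
rewrite big_split /= big_const_seq count_predT iter_addr_0 -[X in X + _]mulr_natl gerDl.
rewrite -big_mkcond sumrB -mulr_suml -!natr_sum -/(good_load st U) -/(load st U).
rewrite -/g -/l.
have gl : g <= l.
  by rewrite ler_nat; apply: leq_sum => f _; case: ifP.
have g0 : 0 <= g by apply: ler0n.
(* The load is an integer: if it is zero so is [g], and otherwise 1 + l <= 2 l, so the gain 2 g l/(1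
   + l) is at least [g]. *)
have [l0|l1] := posnP (load st U).
  by move: gl; rewrite /l l0; lra.
have {}l1 : 1 <= l by rewrite ler1n.
rewrite subr_le0 mulrA ler_pdivlMr; nra.
Qed.

(** Induction on the number of pending elements, splitting on the next arrival. The factor 2 comes
    from [expected_purchase]. *)
Lemma expected_cost_permutations h U : uniq U -> covered (run R h) ->
  (m * size U <= N)%N -> (2 ^ up_log 2 #|x| <= M)%N ->
  \sum_(t <- permutations U)
     expected_cost (learn_or_cover R m) h [seq req e | e <- t]
  <= (size U)`!%:R * (#|picked h|%:R + 2 * potential (run R h) U).
Proof.
move=> + + + xM; have [k] := ubnP (size U).
elim: k U h => // k IH U h Uk uU xst UN.
have [U0|U0] := posnP (size U).
  (* It remains to see that the final potential is nonnegative, by [missed_bound] and K <= M. *)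
  rewrite (size0nil U0) /= big_seq1 /= mul1r lerDl mulr_ge0 //.
  have KM : (K_ (run R h))%:R <= M%:R :> R.
    by rewrite ler_nat (leq_trans (guess_le xst)).
  have mb := missed_bound m_gt0 xst.
  have lm0 : 0 <= lm by [].
  have L0 : 0 <= L by [].
  rewrite /potential.
  have a1 := mulr_ge0 (ler0n R (K_ (run R h))) (ln_load_ge0 (run R h) [::]).
  have a2 : 0 <= L * (M%:R - (K_ (run R h))%:R) by rewrite mulr_ge0 // subr_ge0.
  have a3 : 0 <= lm * (M%:R - (K_ (run R h))%:R) by rewrite mulr_ge0 // subr_ge0.
  lra.
have /= -> := big_permutations (fun t =>
  expected_cost (learn_or_cover R m) h [seq req e | e <- t]) uU U0.
have -> : (size U)`! = (size U * (size U).-1`!)%N by rewrite -{1}(prednK U0) factS prednK.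
apply: (@le_trans _ _ (\sum_(e <- U) (size U).-1`!%:R *
    (#|picked h|%:R + 2 * ((residual (bought (run R h)) (req e))%:R
    + \sum_X sample (inclusion R (run R h) (req e)) X
        * potential (step (run R h) (req e, X :|: backup (bought (run R h)) (req e)))
            (rem e U))))).
  rewrite big_seq [leRHS]big_seq; apply: ler_sum => e eU.
  rewrite /= exchange_big /=.
  apply: (@le_trans _ _ (\sum_A learn_or_cover_response R h (req e) A *
      ((size U).-1`!%:R * (#|picked (rcons h (req e, A))|%:R
        + 2 * potential (run R (rcons h (req e, A))) (rem e U))))).
    apply: ler_sum => A _; rewrite -mulr_sumr ler_wpM2l ?response_ge0 //.
    have srem : size (rem e U) = (size U).-1 by rewrite size_rem.
    rewrite -srem; apply: IH.
    - by rewrite srem prednK.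
    - exact: rem_uniq.
    - by rewrite run_rcons /= all_rcons x_covers.
    - by apply: leq_trans UN; rewrite leq_mul2l srem leq_pred orbT.
  rewrite [leLHS](_ : _ = (size U).-1`!%:R *
      (\sum_A learn_or_cover_response R h (req e) A * #|picked (rcons h (req e, A))|%:R
       + 2 * \sum_A learn_or_cover_response R h (req e) A
               * potential (step (run R h) (req e, A)) (rem e U))); last first.
    rewrite mulrDr !mulr_sumr -big_split /=; apply: eq_bigr => A _.
    by rewrite run_rcons; ring.
  rewrite ler_wpM2l //.
  rewrite (response_expectation h (req e)
    (fun A => potential (step (run R h) (req e, A)) (rem e U))) mulrDr addrA lerD2r.
  by rewrite bought_run; exact: expected_purchase.
rewrite -mulr_sumr big_split /= -mulr_sumr natrM [X in _ <= X * _]mulrC -mulrA.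
rewrite ler_wpM2l // mulrDr big_const_seq count_predT iter_addr_0 -[X in X + _]mulr_natl lerD2l.
rewrite mulrCA ler_wpM2l //; exact: drift.
Qed.

End Potential.
End Drift.

(** * The competitive ratio *)

Lemma expected_cost_trivial (R : realType) m (h : history m) rs :
  {in rs, forall r, r.1 = 0%N} ->
  expected_cost (learn_or_cover R m) h rs <= #|picked h|%:R.
Proof.
elim: rs h => //= r rs IH h rs0.
apply: (@le_trans _ _ (\sum_A learn_or_cover_response R h r A
    * #|picked (rcons h (r, A))|%:R)).
  apply: ler_sum => A _; rewrite ler_wpM2l ?response_ge0 //.
  by apply: IH => r' r'rs; apply: rs0; rewrite inE r'rs orbT.
apply: (le_trans (expected_purchase R h r)).
by rewrite /residual rs0 ?inE ?eqxx // sub0n mulr0 addr0.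
Qed.

Lemma feasibleP m n (I : instance m n) x :
  reflect (forall e, covers x (request_of I e)) (feasible I x).
Proof.
have E e : #|[set j | incidence I e j] :&: x| = (\sum_(j in x) incidence I e j)%N.
  rewrite -sum1_card big_mkcond [RHS]big_mkcond /=; apply: eq_bigr => j _.
  by rewrite !inE; case: (_ \in x); case: (incidence I e j).
by apply: (iffP forallP) => h e; move: (h e); rewrite /covers /= E.
Qed.

Theorem theorem5p1 (R : realType) :
  exists (alg : forall m : nat, online_algorithm R m) (C : R),
    forall (m n : nat) (I : instance m n),
      (exists x : {set 'I_m}, feasible I x) ->
      (forall s : 'S_n, serves (alg m) [::] (arrivals I s)) /\
      ((m * n != 1)%N ->
       random_order_cost (alg m) I <= C * ln ((m * n)%:R) * (opt I)%:R).
Proof.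
(* The estimates give 336 <= 400: the cost is at most twice the initial potential, itself at most 84
   M ln(mn), and M <= 2 opt. *)
exists (learn_or_cover R), 400 => m n I [x0 /feasibleP x0I]; split.
  move=> s; apply: serves_learn_or_cover => _ /mapP[i _ ->].
  exact: covers_setT (x0I _).
move=> mn1; rewrite /opt; case: arg_minnP => [|x /feasibleP xI _].
  by apply/feasibleP => e; exact: covers_setT (x0I e).
(* A zero optimum forces all demands to be zero, and the cost must vanish exactly. *)
have [x_0|x_gt0] := posnP #|x|.
  rewrite x_0 mulr0 /random_order_cost pmulr_lle0 ?invr_gt0 ?ltr0n ?fact_gt0 //.
  apply: sumr_le0 => s _.
  have : expected_cost (learn_or_cover R m) [::] (arrivals I s) 
      <= #|picked ([::] : history m)|%:R.
    apply: expected_cost_trivial => _ /mapP[i _ ->] /=.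
    apply/eqP; rewrite -leqn0; apply: leq_trans (xI (s i)) _.
    by rewrite -x_0 subset_leq_card // subsetIr.
  by rewrite /picked big_nil cards0.
have m_gt0 : (0 < m)%N.
  by rewrite -[m]card_ord (leq_trans x_gt0) // max_card.
rewrite /random_order_cost ler_pdivrMr ?ltr0n ?fact_gt0 //.
under eq_bigr do rewrite /arrivals map_comp.
rewrite (big_perm_permutations (fun t =>
  expected_cost (learn_or_cover R m) [::] [seq request_of I e | e <- t])).
(* For [n = 0] the convention [ln 0 = 0] makes the bound zero, but nothing is bought. *)
have [n0|n_gt0] := posnP n.
  rewrite big_seq big1 => [|t]; first by rewrite n0 muln0 ln0 // mulr0 !mul0r.
  rewrite mem_permutations => /perm_size; rewrite size_enum_ord => tn.
  have /size0nil -> : size t = 0%N by rewrite tn.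
  by rewrite /= /picked big_nil cards0.
have mn2 : (2 <= m * n)%N by rewrite ltn_neqAle eq_sym mn1 muln_gt0 m_gt0.
set M := (2 ^ up_log 2 #|x|)%N.
have := @expected_cost_permutations R m _ (request_of I) x xI (m * n) M m_gt0
  [::] (enum 'I_n) (enum_uniq _) isT.
rewrite size_enum_ord => /(_ (leqnn _) (leqnn _)) /le_trans; apply.
rewrite mulrC ler_wpM2r // /picked big_nil cards0 add0r.
have M_le : M%:R <= 2 * #|x|%:R :> R.
  rewrite -natrM ler_nat /M.
  have [x1|x2] := leqP #|x| 1.
    by rewrite (eqP (_ : up_log 2 #|x| == 0)%N) ?up_log_eq0 ?x1 // expn0; lia.
  have := up_log_gtn (isT : 1 < 2)%N x2.
  have : (0 < up_log 2 #|x|)%N by rewrite up_log_gt0.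
  by case: (up_log 2 #|x|) => // k _ /=; rewrite expnS; lia.
have M1 : 1 <= M%:R :> R by rewrite ler1n expn_gt0.
have K1 : guess (seen (run R [::] : state m)) = 1%N.
  rewrite /= /guess (_ : cover_number _ = 0%N) ?up_log0 //.
  have [_] := @cover_numberP m [::] set0 isT.
  by rewrite cards0 leqn0 => /eqP.
set l := ln (m * n)%:R.
have l_ge : 1 / 2 <= l.
  by apply: le_trans (ln2_ge_half R) _; rewrite ler_ln ?posrE ?ltr0n ?ler_nat //; lia.
have lm_le : ln m%:R <= l :> R.
  by rewrite ler_ln ?posrE ?ltr0n ?ler_nat //; nia.
have L_le : ln (1 + (m * n)%:R) <= 2 * l :> R.
  have -> : 2 * l = ln ((m * n)%:R ^+ 2).
    by rewrite lnXn ?ltr0n ?mulr_natl //; lia.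
  rewrite ler_ln ?posrE ?ltr_pwDl ?exprn_gt0 ?ltr0n //; last by lia.
  by rewrite -natrX -(natrD _ 1) ler_nat; nia.
have L0 : 0 <= ln (1 + (m * n)%:R) :> R by rewrite ln_ge0 // lerDl.
have lm0 : 0 <= ln m%:R :> R by rewrite ln_ge0 // ler1n.
have load_le : ln (1 + (load (request_of I) (run R [::]) (enum 'I_n))%:R)
    <= ln (1 + (m * n)%:R) :> R.
  by apply: (@ln_load_le R m _ _ x xI (m * n)); rewrite size_enum_ord.
rewrite /potential K1 [missed _]/=.
set L := ln (1 + (m * n)%:R) in load_le L_le L0 *.
set x1 := #|x|%:R in M_le *.
have a1 : L * M%:R <= 2 * l * M%:R by rewrite ler_wpM2r.
have a2 : ln m%:R * M%:R <= l * M%:R by rewrite ler_wpM2r.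
have a3 : l * M%:R <= l * (2 * x1) by rewrite ler_wpM2l //; lra.
have a4 : 1 / 2 * M%:R <= l * M%:R by rewrite ler_wpM2r.
lra.
Qed.
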